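(* For each positive integer $n$, let $\mathcal{F}$ be an atomic system of subsets of $[n]=\{1,\dots,n\}$ such that for any two disjoint members $A,B\in\mathcal{F}$, either there exists $a\in A$ such that $B\cup\{a\}\in\mathcal{F}$, or there exists $b\in B$ such that $A\cup\{b\}\in\mathcal{F}$; moreover, suppose that whenever $A,B\in\mathcal{F}$ are disjoint with $|A|<|B|$, there exists $b\in B$ such that $A\cup\{b\}\in\mathcal{F}$. Then $|\mathcal{F}|\ge 2^{(1/2+o(1))\sqrt{n}\log n}$, where $\log$ is the base-2 logarithm and $o(1)$ denotes a quantity tending to $0$ as $n\to\infty$ (uniformly over all such $\mathcal{F}$).
   Context: A system $\mathcal{F}$ of subsets of $[n]$ is called atomic if $\emptyset\in\mathcal{F}$ and $\{a\}\in\mathcal{F}$ for every $a\in[n]$. *)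

(* Defs.v *)
From mathcomp Require Import all_boot all_order all_algebra.
From mathcomp Require Import all_classical all_reals all_analysis.
Import Order.TTheory GRing.Theory Num.Theory numFieldNormedType.Exports.

Set Implicit Arguments.
Unset Strict Implicit.
Unset Printing Implicit Defensive.

Local Open Scope ring_scope.

(* The ground set {1, ..., n} is represented by 'I_n = {0, ..., n - 1}. *)
Definition atomic (n : nat) (F : {set {set 'I_n}}) : Prop :=
  finset.set0 \in F /\ forall a : 'I_n, [set a]%SET \in F.

(* The empty set is disjoint from itself, and for A = B = set0 no a or b can
   exist; as set0 belongs to every atomic system, that one pair must be
   excluded for the condition to be satisfiable.  For disjoint A and B, the
   hypothesis A != B excludes exactly that pair. *)
Definition disjoint_augmentable (n : nat) (F : {set {set 'I_n}}) : Prop :=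
  forall A B : {set 'I_n}, A \in F -> B \in F -> [disjoint A & B] -> A != B ->
    (exists2 a, a \in A & (a |: B)%SET \in F) \/
    (exists2 b, b \in B & (b |: A)%SET \in F).

Definition disjoint_exchange (n : nat) (F : {set {set 'I_n}}) : Prop :=
  forall A B : {set 'I_n}, A \in F -> B \in F -> [disjoint A & B] ->
    (#|A| < #|B|)%N -> exists2 b, b \in B & (b |: A)%SET \in F.

Definition log2 (R : realType) (x : R) : R := ln x / ln 2.

(* Main.v *)
(** If [T] contains no member of size more than [i], then [#|T| <= i(i+1)/2]:
    repeatedly removing a largest member, disjoint augmentation forbids two
    consecutive removed members to have the same size. By disjoint exchange,
    the elements [b] that fail to extend a member [A] of size [i] form such a
    set, so for [i < k := floor (sqrt n)] every [A] has at least [n / 4]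
    one-element extensions in the system. Counting pairs (member of size [i],
    extension) gives [n ^ k <= 4 ^ k * k! * #|F|] with [k! <= n ^ (k / 2)]. *)
Require Import Defs.
From mathcomp Require Import all_boot all_order all_algebra.
From mathcomp Require Import all_classical all_reals all_analysis.
From mathcomp Require Import zify ring lra.
Import Order.TTheory GRing.Theory Num.Theory numFieldNormedType.Exports.

Set Implicit Arguments.
Unset Strict Implicit.
Unset Printing Implicit Defensive.

Local Open Scope classical_set_scope.
Local Open Scope ring_scope.

Lemma card_le_bin_of_small_members (n : nat) (F : {set {set 'I_n}}) :
  atomic F -> disjoint_augmentable F ->
  forall (i : nat) (T : {set 'I_n}),
    (forall A : {set 'I_n}, A \in F -> A \subset T -> (#|A| <= i)%N) ->
    (#|T| <= 'C(i.+1, 2))%N.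
Proof.
move=> [_ F1] augF; elim=> [|i IH] T leT.
  rewrite bin_small // leqn0 cards_eq0; apply/eqP/setP => x; rewrite inE.
  apply/negbTE/negP => xT.
  by have := leT _ (F1 x); rewrite finset.sub1set xT cards1 => /(_ isT).
case: (pickP [pred A : {set 'I_n} | [&& A \in F, A \subset T & #|A| == i.+1]]).
  move=> A /= /and3P[AF AT /eqP cA].
  (* By Pascal's rule the target exceeds the bound for [i] by exactly [i.+1], the size of [A]; so
     the induction hypothesis is needed for [T] minus [A]. *)
  rewrite -(cardsID A T) (finset.setIidPr AT) cA binS bin1 addnC leq_add2r.
  apply: IH => B BF; rewrite subsetD => /andP[BT dBA].
  have := leT B BF BT; rewrite leq_eqVlt => /orP[/eqP cB|//].
  have neqBA : B != A.
    by apply: contraTneq dBA => ->; rewrite -setI_eq0 finset.setIid -cards_eq0 cA.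
  (* If [B] also had size [i.+1], augmenting either of [A], [B] from the other would create a member
     of size [i.+2] inside [T]. *)
  have big (C D : {set 'I_n}) (c : 'I_n) : C \subset T -> D \subset T ->
      [disjoint C & D]%B -> #|D| = i.+1 -> c \in C -> (c |: D)%SET \notin F.
    move=> CT DT dCD cD cC; apply/negP => /leT.
    rewrite finset.subUset finset.sub1set (fintype.subsetP CT) // DT cardsU1 cD.
    by rewrite (disjointFr dCD cC) /= ltnn => /(_ isT).
  have [[b bB]|[a aA]] := augF B A BF AF dBA neqBA; apply: contraLR => _.
    exact: (big B A).
  by apply: (big A B) => //; rewrite disjoint_sym.
move=> noA; apply: leq_trans (IH T _) _; last by rewrite leq_bin2l.
move=> A AF AT; have := leT A AF AT; rewrite leq_eqVlt => /orP[cA|//].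
by have := noA A; rewrite /= AF AT cA.
Qed.

(** Let [T] be the set of points outside [A] that do not extend [A]. A member inside [T] larger than
    [A] would, by exchange, contain a point extending [A]. Hence the previous lemma bounds [T]. *)
Lemma card_extensions (n : nat) (F : {set {set 'I_n}}) (A : {set 'I_n}) :
  atomic F -> disjoint_augmentable F -> disjoint_exchange F -> A \in F ->
  (n <= #|[set b | (b \notin A) && ((b |: A)%SET \in F)]|%SET
        + #|A| + 'C(#|A|.+1, 2))%N.
Proof.
move=> atF augF excF AF; set E := finset _.
have leT : (#|~: (E :|: A)%SET| <= 'C(#|A|.+1, 2))%N.
  apply: (card_le_bin_of_small_members atF augF) => B BF BT.
  rewrite leqNgt; apply/negP => ltAB.
  have dAB : [disjoint A & B]%B.
    rewrite disjoint_sym finset.disjoints_subset (fintype.subset_trans BT) //.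
    by rewrite finset.setCS finset.subsetUr.
  have [b bB bF] := excF A B AF BF dAB ltAB.
  have := fintype.subsetP BT b bB.
  by rewrite !inE bF andbT negb_or negbK andbN.
rewrite -[X in (X <= _)%N](card_ord n) -(cardsC (E :|: A)%SET).
apply: leq_add leT; exact: leq_card_setU.
Qed.

Definition level (n : nat) (F : {set {set 'I_n}}) (i : nat) : {set {set 'I_n}} :=
  [set A in F | #|A| == i]%SET.

Lemma level_double_count (n : nat) (F : {set {set 'I_n}}) (i m : nat) :
  (forall A : {set 'I_n}, A \in level F i ->
    m <= #|[set b | (b \notin A) && ((b |: A)%SET \in F)]|%SET)%N ->
  (m * #|level F i| <= i.+1 * #|level F i.+1|)%N.
Proof.
move=> leE.
pose ext (A : {set 'I_n}) b := (b \notin A) && ((b |: A)%SET \in F).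
apply: (@leq_trans (\sum_(A in level F i) \sum_(b | ext A b) 1)).
  rewrite mulnC -sum_nat_const; apply: leq_sum => A /leE.
  by rewrite -sum1dep_card.
rewrite pair_big_dep /= sum1dep_card.
apply: (@leq_trans (\sum_(B in level F i.+1) \sum_(b in B) 1)); last first.
  rewrite (eq_bigr (fun=> i.+1)); first by rewrite sum_nat_const mulnC.
  by move=> B; rewrite inE sum1_card => /andP[_ /eqP].
rewrite pair_big_dep /= sum1dep_card.
(* Keeping the added point makes the map injective: the smaller set is recovered by deleting that
   point. *)
pose f (p : {set 'I_n} * 'I_n) := ((p.2 |: p.1)%SET, p.2).
have injf : {in [set p | (p.1 \in level F i) && ext p.1 p.2]%SET &, injective f}.
  move=> [A a] [B b]; rewrite !inE /ext /= => /and3P[_ aA _] /and3P[_ bB _] [eAB eab].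
  by rewrite -eab in bB eAB *; rewrite -(finset.setU1K aA) eAB finset.setU1K.
rewrite -(card_in_imset injf); apply: subset_leq_card.
apply/fintype.subsetP => _ /imsetP[[A a] + ->]; rewrite !inE /ext /=.
by case/and3P=> /andP[AF /eqP cA] aA ->; rewrite cardsU1 aA cA eqxx eqxx.
Qed.

Lemma exp_le_card_system (n : nat) (F : {set {set 'I_n}}) (k : nat) :
  atomic F -> disjoint_augmentable F -> disjoint_exchange F -> (k * k <= n)%N ->
  (n ^ k <= 4 ^ k * k`! * #|F|)%N.
Proof.
move=> atF augF excF kkn.
have step i : (i < k)%N -> (n * #|level F i| <= 4 * i.+1 * #|level F i.+1|)%N.
  move=> ik; set m := (n - (i + 'C(i.+1, 2)))%N.
  have nm : (n <= 4 * m)%N.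
    have c2 : (2 * 'C(i.+1, 2) = i.+1 * i)%N.
      by rewrite mul2n bin2 even_halfK // oddM /= andNb.
    have le_n : (i.+1 * i.+1 <= n)%N by apply: leq_trans kkn; apply: leq_mul.
    (* The left side is [2 * i * (i + 3)], at most [3 * (i + 1) ^ 2], and [(i + 1) ^ 2 <= n]. *)
    suff : (4 * (i + 'C(i.+1, 2)) <= 3 * n)%N by rewrite /m; lia.
    by nia.
  have le_m : (m * #|level F i| <= i.+1 * #|level F i.+1|)%N.
    apply: level_double_count => A; rewrite inE => /andP[AF /eqP cA].
    have := card_extensions atF augF excF AF.
    by rewrite cA -addnA /m leq_subLR addnC.
  by nia.
have levels j : (j <= k)%N -> (n ^ j <= 4 ^ j * j`! * #|level F j|)%N.
  elim: j => [_|j IH jk].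
    rewrite !mul1n card_gt0; apply/finset.set0Pn; exists finset.set0.
    by rewrite inE finset.cards0 eqxx andbT; case: atF.
  have := step j jk; have := IH (ltnW jk); rewrite !expnS factS.
  move=> /(leq_mul (leqnn n)) h1 /(leq_mul (leqnn (4 ^ j * j`!)))%N h2.
  by apply: leq_trans h1 _; lia.
apply: leq_trans (levels k (leqnn k)) _; rewrite leq_mul2l; apply/orP; right.
by apply: subset_leq_card; apply/fintype.subsetP => A; rewrite inE => /andP[].
Qed.

(** Squaring the counting bound avoids the half-integer exponent: [k! ^ 2 <= k ^ (2 * k) <= n ^ k],
    so one factor [n ^ k] cancels. Half the logarithm of what remains gives the exponent. *)
Lemma pow2_le_card_system (R : realType) (n : nat) (F : {set {set 'I_n}}) (k : nat) :
  (0 < n)%N -> atomic F -> disjoint_augmentable F -> disjoint_exchange F ->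
  (k * k <= n)%N ->
  2 `^ (k%:R * (1 / 2 * log2 (n%:R : R) - 2)) <= #|F|%:R.
Proof.
move=> n0 atF augF excF kkn; set x := #|F|.
have x0 : (0 < x)%N by rewrite card_gt0; apply/finset.set0Pn; exists finset.set0; case: atF.
have fact_le j : (j <= k)%N -> (j`! <= k ^ j)%N.
  elim: j => // j IH jk; rewrite factS expnS leq_mul // IH //; exact: ltnW.
have le_n : (n ^ k <= 2 ^ (4 * k) * x ^ 2)%N.
  have nk0 : (0 < n ^ k)%N by rewrite expn_gt0 n0.
  rewrite -(leq_pmul2l nk0).
  have le1 := exp_le_card_system atF augF excF kkn.
  have le2 : (k`! ^ 2 <= n ^ k)%N.
    apply: (@leq_trans ((k ^ k) ^ 2)); first by rewrite leq_exp2r // fact_le.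
    rewrite -expnM mulnC expnM; case: (k) kkn => [|j] kkn //.
    by rewrite leq_exp2r // -mulnn.
  have := leq_mul le1 le1.
  have -> : (2 ^ (4 * k) = 4 ^ k * 4 ^ k)%N.
    by rewrite (_ : 4 = 2 ^ 2)%N // -!expnM -expnD; congr (_ ^ _)%N; lia.
  move=> /leq_trans; apply.
  have := leq_mul (leqnn (4 ^ k * 4 ^ k * x ^ 2))%N le2.
  by rewrite !expnS !expn0; lia.
have ln2_gt0 : 0 < ln (2 : R) by rewrite ln_gt0 // ltr1n.
have n0R : 0 < n%:R :> R by rewrite ltr0n.
have x0R : 0 < x%:R :> R by rewrite ltr0n.
have : ln (n%:R ^+ k : R) <= ln (2 ^+ (4 * k) * x%:R ^+ 2 : R).
  rewrite ler_ln ?posrE ?mulr_gt0 ?exprn_gt0 //.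
  by rewrite -!natrX -natrM ler_nat.
rewrite lnM ?posrE ?exprn_gt0 // !lnXn // => le_ln.
rewrite /powR pnatr_eq0 /= -[leRHS]lnK ?posrE // ler_expR /log2.
have -> : k%:R * (1 / 2 * (ln n%:R / ln 2) - 2) * ln 2 =
    1 / 2 * (k%:R * ln n%:R) - 2 * k%:R * ln 2 :> R.
  by field; rewrite gt_eqF.
move: le_ln; rewrite -[_ *+ k]mulr_natl -[_ *+ (4 * k)]mulr_natl natrM.
rewrite -[_ *+ 2]mulr_natl; lra.
Qed.

Lemma cvg_sqrt_natr (R : realType) : Num.sqrt (n%:R : R) @[n --> \oo] --> +oo.
Proof.
apply/cvgryPge => A.
have [n0 _ le_n0] := nbhs_infty_ger (A ^+ 2).
exists n0 => // n /= /le_n0 le_n.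
apply: le_trans (ler_norm A) _.
by rewrite -sqrtr_sqr ler_wsqrtr.
Qed.

Lemma cvg_log2_natr (R : realType) : log2 (n%:R : R) @[n --> \oo] --> +oo.
Proof.
apply/cvgryPge => A.
have [n0 _ le_n0] := nbhs_infty_ger (expR (A * ln 2)).
exists n0 => // n /= /le_n0 le_n.
have n_gt0 : 0 < n%:R :> R by apply: lt_le_trans (expR_gt0 _) le_n.
rewrite /log2 ler_pdivlMr ?ln_gt0 ?ltr1n //.
by rewrite -ler_expR lnK ?posrE.
Qed.

(** Truncation loses less than 1, so the ratio is squeezed between [1 - 1 / u n] and 1. *)
Lemma cvg_truncn_ratio (R : realType) (u : nat -> R) :
  u n @[n --> \oo] --> +oo -> (Num.truncn (u n))%:R / u n @[n --> \oo] --> (1 : R).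
Proof.
move=> uy; have u_gt0 : \forall n \near \oo, 0 < u n by move/cvgryPgt : uy; apply.
have uV : (u n)^-1 @[n --> \oo] --> (0 : R) by apply/gtr0_cvgV0.
apply: (@squeeze_cvgr _ _ _ _ (fun n => 1 - (u n)^-1) (fun=> 1)).
- near=> n; have un0 : 0 < u n by near: n.
  have /andP[le_tr lt_tr] := truncn_itv (ltW un0).
  rewrite ler_pdivlMr // ler_pdivrMr // mul1r le_tr andbT mulrBl mul1r.
  by rewrite mulVf ?gt_eqF // lerBlDr -natr1 in lt_tr *; exact: ltW.
- by rewrite -[X in _ --> X]subr0; apply: cvgB => //; exact: cvg_cst.
- exact: cvg_cst.
Unshelve. all: by end_near. Qed.

Theorem theorem2 (R : realType) :
  exists eps : nat -> R,
    (eps n @[n --> \oo] --> (0 : R)) /\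
    forall (n : nat) (F : {set {set 'I_n}}),
      (0 < n)%N -> atomic F -> disjoint_augmentable F -> disjoint_exchange F ->
      2 `^ ((1 / 2 + eps n) * Num.sqrt n%:R * log2 (n%:R : R)) <= #|F|%:R.
Proof.
pose s n : R := Num.sqrt n%:R; pose L n : R := log2 (n%:R : R).
(* Chosen so that, for [n > 1], the exponent equals [k * (1 / 2 * L n - 2)] with [k] the truncation
   of [s n]. *)
exists (fun n => (Num.truncn (s n))%:R / s n * (1 / 2 - 2 / L n) - 1 / 2); split.
  have -> : (0 : R) = 1 * (1 / 2 - 2 * 0) - 1 / 2 by ring.
  apply: cvgB; last exact: cvg_cst.
  apply: cvgM; first exact/cvg_truncn_ratio/cvg_sqrt_natr.
  apply: cvgB; first exact: cvg_cst.
  apply: cvgM; first exact: cvg_cst.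
  apply/gtr0_cvgV0; last exact: cvg_log2_natr.
  by have /cvgryPgt := @cvg_log2_natr R; apply.
move=> n F n0 atF augF excF; rewrite -/(s n) -/(L n).
have s_gt0 : 0 < s n by rewrite sqrtr_gt0 ltr0n.
(* At [n = 1] the logarithm vanishes and [L n] cannot be cancelled; the claim is then just that the
   system is nonempty. *)
have [n1|n_gt1] := leqP n 1.
  have -> : L n = 0 by rewrite /L (_ : n = 1%N) /log2 ?ln1 ?mul0r //; lia.
  rewrite mulr0 powRr0 ler1n card_gt0.
  by apply/finset.set0Pn; exists finset.set0; case: atF.
have L_neq0 : L n != 0.
  by rewrite /L /log2 gt_eqF // divr_gt0 // ln_gt0 ?ltr1n.
have -> : (1 / 2 + ((Num.truncn (s n))%:R / s n * (1 / 2 - 2 / L n) - 1 / 2)) * s n * L n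
    = (Num.truncn (s n))%:R * (1 / 2 * L n - 2).
  by field; rewrite L_neq0 gt_eqF.
apply: pow2_le_card_system => //.
rewrite -(ler_nat R) natrM -expr2 -[leRHS]sqr_sqrtr ?ler0n //.
rewrite lerXn2r ?nnegrE ?sqrtr_ge0 //.
by have /andP[] := truncn_itv (ltW s_gt0).
Qed.
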